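(* Let $p$ be a prime, $k \in \mathbb{N}$, $q = p^k$, $m \in \mathbb{N}$ and $c_1,\dots,c_m \in \mathbb{N}$. Then the set $B(q; c_1,\dots,c_m; 1,\dots,1) = \{ \sum_{j=1}^m c_j q^{n_j} : n_1,\dots,n_m \in \mathbb{N}_0\}$ is an $\overline{\mathbb{F}_p}(t)$-DML set over split torus.
   Context: For a field $K$ and a quasi-projective variety $X$ over $K$, a set $S \subseteq \mathbb{N}_0$ is a $K$-DML set over $X$ if there exist an endomorphism $\Phi$ of $X$ (a morphism $X \to X$ defined over $K$), a point $\alpha \in X(K)$ and a closed subvariety $V \subseteq X$ defined over $K$ (not necessarily irreducible) such that $S = \{ n \in \mathbb{N}_0 : \Phi^n(\alpha) \in V(K)\}$. $S$ is a $K$-DML set over split torus if it is a $K$-DML set over $\mathbb{G}_m^k$ for some $k \in \mathbb{N}$. $\mathbb{N}$ denotes the positive integers and $\mathbb{N}_0 = \mathbb{N}\cup\{0\}$. *)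

(* Defs.v *)
From HB Require Import structures.
From mathcomp Require Import all_boot all_order all_algebra.
From mathcomp Require Import mpoly.
Set Implicit Arguments. Unset Strict Implicit. Unset Printing Implicit Defensive.
Import Order.TTheory GRing.Theory Num.Theory.
Local Open Scope ring_scope.

Definition is_alg_closure_Fp (p : nat) (L : closedFieldType) : Prop :=
  p \in [pchar L] /\
  forall x : L, exists2 P : {poly L}, P != 0 &
     (forall i : nat, exists n : nat, P`_i = n%:R) /\ root P x.

Definition in_Gm (K : fieldType) (d : nat) (x : 'I_d -> K) : Prop :=
  forall i, x i != 0.

(* A unit of the Laurent polynomial ring K[x_1^{+-1},...,x_d^{+-1}]
   written as P / x^E with P a polynomial and E a monomial exponent:
   it is a unit iff P divides a monomial. *)
Definition laurent_unit (K : fieldType) (d : nat) (P : {mpoly K[d]}) : Prop :=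
  exists (Q : {mpoly K[d]}) (m : 'X_{1..d}), P * Q = 'X_[m].

(* An endomorphism of G_m^d over K (morphism G_m^d -> G_m^d defined over K),
   i.e. a d-tuple of units of the coordinate ring K[x^{+-1}], acting on
   K-points. Values off G_m^d(K) are irrelevant. *)
Definition Gm_endo (K : fieldType) (d : nat)
  (f : ('I_d -> K) -> ('I_d -> K)) : Prop :=
  exists (P : 'I_d -> {mpoly K[d]}) (E : 'I_d -> 'X_{1..d}),
    (forall i, laurent_unit (P i)) /\
    forall x, in_Gm x -> forall i, f x i = (P i).@[x] / ('X_[E i] : {mpoly K[d]}).@[x].

(* K-points of the closed subvariety of G_m^d cut out by the (Laurent, wlog
   polynomial) equations in s. *)
Definition in_closed_subvar (K : fieldType) (d : nat) (s : seq {mpoly K[d]})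
  (x : 'I_d -> K) : Prop :=
  in_Gm x /\ forall P, P \in s -> P.@[x] = 0.

Definition DML_set_Gm (K : fieldType) (d : nat) (S : nat -> Prop) : Prop :=
  exists (f : ('I_d -> K) -> ('I_d -> K)) (a : 'I_d -> K) (s : seq {mpoly K[d]}),
    Gm_endo f /\ in_Gm a /\
    forall n : nat, S n <-> in_closed_subvar s (iter n f a).

Definition DML_set_split_torus (K : fieldType) (S : nat -> Prop) : Prop :=
  exists d : nat, (0 < d)%N /\ DML_set_Gm K d S.

Definition B_set (q m : nat) (c : 'I_m -> nat) : nat -> Prop :=
  fun n => exists ns : 'I_m -> nat, n = (\sum_(j < m) c j * q ^ ns j)%N.

(* Main.v *)
Require Import Defs.
From HB Require Import structures.
From mathcomp Require Import all_boot all_order all_algebra.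
From mathcomp Require Import perm separable.
From mathcomp Require Import zify.
From mathcomp Require Import mpoly.

(** For [n = sum_j c_j q^(n_j)] and [b] fixed by a power [p^r] of Frobenius, [(b - t)^n] is the
    value at (a twist of) [b] of a polynomial [prod_j (X^(q^(sigma_j)) - t^(q^(n_j)))^(c_j)],
    where [sigma_j] only depends on [n_j] modulo a fixed period. After a rotation of the
    [sigma_j] its degree is below the number [p^r] of nodes, so that it is the interpolating
    polynomial and its coefficients are linear in the coordinates [(b - t)^n]. That the roots
    of this polynomial coincide in blocks of sizes [c_j q^(sigma_j)] is a closed condition.

    Conversely, if the interpolating polynomial is monic of the right degree, differentiation
    with respect to [t] shows by descent on [n] that all its roots are powers
    [t^(q^i)] with [i] in [Z], so the block condition gives [n = sum_j c_j q^(n_j)] with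
    [n_j] in [Z]. Negative [n_j] do occur for a plain translation of the torus. They are
    avoided by splitting [n] into classes modulo [q^h], which a cyclic shift of coordinates
    records: the terms with [n_j < h] are subtracted, and a sum of the remaining [c_j q^(n_j)]
    that is divisible by [q^h] can only involve [n_j >= 0] when [h] is large. *)

Set Implicit Arguments. Unset Strict Implicit. Unset Printing Implicit Defensive.
Import Order.TTheory GRing.Theory Num.Theory.
Local Open Scope ring_scope.

(** * Base-q expansions *)

(** The largest exponent dominates: the sum is at most [q ^ (l + n j0)], so [a <= l + n j0].
    Removing that term keeps divisibility by [q ^ (a - l)], and each removal costs [l]. *)
Lemma dvdn_sum_pow_gap (I : finType) (q l : nat) (c n : I -> nat) (A : {set I}) (a : nat) :
  (1 < q)%N -> (forall j, j \in A -> 0 < c j)%N ->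
  (\sum_(j in A) c j <= q ^ l)%N ->
  (q ^ a %| \sum_(j in A) c j * q ^ n j)%N ->
  forall j, j \in A -> (a <= n j + l * #|A|)%N.
Proof.
move=> q1; elim: {A}#|A| {-2}A (erefl #|A|) a => [|k IH] A cA a c0 cl da j jA.
  by move/eqP: cA jA; rewrite cards_eq0 => /eqP ->; rewrite inE.
pose j0 := [arg max_(i > j in A) n i].
have [j0A j0max] : j0 \in A /\ forall i, i \in A -> (n i <= n j0)%N.
  by rewrite /j0; case: arg_maxnP => // i iA imax; split.
have q0 : (0 < q)%N by apply: leq_trans q1.
have al : (a <= l + n j0)%N.
  rewrite -(leq_exp2l _ _ q1); apply: leq_trans (dvdn_leq _ da) _.
    by rewrite (bigD1 j) //= addn_gt0 muln_gt0 c0 // expn_gt0 q0.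
  rewrite expnD; apply: leq_trans (leq_mul cl (leqnn _)).
  rewrite big_distrl /=; apply: leq_sum => i iA.
  by rewrite leq_mul2l leq_pexp2l ?j0max ?orbT.
rewrite cA; have [->|nj] := eqVneq j j0.
  by rewrite addnC (leq_trans al) // leq_add2r mulnS leq_addr.
have : (a - l <= n j + l * k)%N; last by rewrite mulnS; lia.
have sD F : (\sum_(i in A) F i = F j0 + \sum_(i in A :\ j0) F i)%N by rewrite (big_setD1 j0).
have cA' : #|A :\ j0| = k by move: cA; rewrite (cardsD1 j0) j0A => -[].
rewrite -[in (l * k)%N]cA'.
apply: (IH (A :\ j0)) => //; last by rewrite !inE nj.
- by move=> i /setD1P[_ iA]; exact: c0.
- by apply: leq_trans cl; rewrite [leqRHS]sD leq_addl.
have d1 : (q ^ (a - l) %| q ^ n j0)%N by rewrite dvdn_exp2l //; lia.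
have d2 : (q ^ (a - l) %| \sum_(i in A) c i * q ^ n i)%N.
  by apply: dvdn_trans da; rewrite dvdn_exp2l // leq_subr.
by move: d2; rewrite sD dvdn_addr // dvdn_mull.
Qed.

(** Each [j] excludes [l] of the [m * l + 1] shifts, so some shift survives. *)
Lemma exists_rotation (m l : nat) (n : 'I_m -> nat) :
  exists2 w, (w < (m * l).+1)%N &
    forall j, ((n j + w) %% (m * l).+1 < (m * l).+1 - l)%N.
Proof.
set N := (m * l).+1; have N0 : (0 < N)%N by [].
have [/existsP[w /forallP wP]|] :=
  boolP [exists w : 'I_N, [forall j, (n j + w) %% N < N - l]%N].
  by exists w.
rewrite negb_exists => /forallP H; exfalso.
have {}H (w : 'I_N) : exists j, (N - l <= (n j + w) %% N)%N.
  by move: (H w); rewrite negb_forall => /existsP[j]; rewrite -leqNgt; exists j.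
case: l => [|l] in N N0 H *.
  by case: (H (Ordinal N0)) => j; rewrite subn0 leqNgt ltn_mod N0.
pose g w := xchoose (H w); have gP w : (N - l.+1 <= (n (g w) + w) %% N)%N := xchooseP (H w).
(* Recording a guilty [j] and its distance from the top would inject the [N] shifts into a set of
   [N - 1] pairs. *)
pose F (w : 'I_N) := (g w, inord (N.-1 - (n (g w) + w) %% N) : 'I_l.+1).
suff /leq_card : injective F by rewrite card_prod !card_ord /N; lia.
move=> w1 w2 [eg /(congr1 val)]; have := gP w1; have := gP w2; rewrite /= -eg.
have lt1 := ltn_pmod (n (g w1) + w1) N0; have lt2 := ltn_pmod (n (g w1) + w2) N0.
move=> le2 le1; rewrite !inordK; try lia; move=> e12.
have /eqP : (n (g w1) + w1 = n (g w1) + w2 %[mod N])%N by lia.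
by rewrite eqn_modDl !modn_small // => /eqP /val_inj.
Qed.

(** * Coincidences among the roots of a polynomial *)

Section RootCoincidences.
Variables (K : fieldType) (D : nat) (pi : 'I_D -> 'I_D).

(** The powers of the auxiliary variable gather the [D] equations of one permutation into one
    factor; the product expresses that some permutation works and makes the coefficients
    symmetric. *)
Definition coincidence_poly : {poly {mpoly K[D]}} :=
  \prod_(s : 'S_D) \sum_(i < D) ('X_(s i) - 'X_(s (pi i)))%:P * 'X^i.

Lemma coincidence_poly_sym e : coincidence_poly`_e \is symmetric.
Proof.
apply/issymP => s; rewrite -coef_map.
suff -> : map_poly (msym s) coincidence_poly = coincidence_poly by [].
rewrite rmorph_prod /= [RHS](reindex_inj (mulIg s)) /=.
apply: eq_bigr => u _; rewrite rmorph_sum /=; apply: eq_bigr => i _.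
rewrite rmorphM /= map_polyXn map_polyC /= msymB !permM.
by rewrite /msym !mmapX !mmap1U.
Qed.

Lemma meval_coincidence_poly (v : 'I_D -> K) :
  map_poly (meval v) coincidence_poly = 0 <->
  exists s : 'S_D, forall i, v (s i) = v (s (pi i)).
Proof.
rewrite rmorph_prod /=.
have E (s : 'S_D) : map_poly (meval v) (\sum_(i < D) ('X_(s i) - 'X_(s (pi i)))%:P * 'X^i)
    = \sum_(i < D) (v (s i) - v (s (pi i))) *: 'X^i.
  rewrite rmorph_sum /=; apply: eq_bigr => i _.
  by rewrite rmorphM /= map_polyXn map_polyC /= mevalB !mevalXU mul_polyC.
split.
  move/eqP/prodf_eq0 => [s _]; rewrite E => /eqP Es; exists s => i.
  move/(congr1 (fun P : {poly K} => P`_i)): Es.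
  rewrite coef0 coef_sum (bigD1 i) //= big1 => [|j /negPf nij].
    by rewrite addr0 coefZ coefXn eqxx mulr1 => /eqP; rewrite subr_eq0 => /eqP.
  by rewrite coefZ coefXn eq_sym val_eqE nij mulr0.
case=> s Es; apply/eqP/prodf_eq0; exists s => //; rewrite E big1 // => i _.
by rewrite Es subrr scale0r.
Qed.

(* Symmetric functions of the roots are polynomials in the coefficients. *)
Lemma root_coincidence_closed :
  exists Ts : seq {mpoly K[D]}, forall cs : D.-tuple K,
    (forall T, T \in Ts -> T.@[fun i : 'I_D => (\prod_(c <- cs) ('X - c%:P))`_i] = 0)
    <-> exists s : 'S_D, forall i, tnth cs (s i) = tnth cs (s (pi i)).
Proof.
(* By Vieta, the elementary symmetric function of degree [i + 1] of the roots is [(-1) ^ (i + 1)]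
   times the coefficient of degree [D - 1 - i]. *)
pose lq : D.-tuple {mpoly K[D]} := [tuple (-1) ^+ i.+1 *: 'X_(rev_ord i) | i < D].
pose T e := sval (sym_fundamental (coincidence_poly_sym e)) \mPo lq.
have TE (cs : D.-tuple K) e :
    (T e).@[fun i : 'I_D => (\prod_(c <- cs) ('X - c%:P))`_i]
    = (coincidence_poly`_e).@[tnth cs].
  rewrite /T; case: sym_fundamental => t /= [<- _]; rewrite !comp_mpoly_meval.
  apply: meval_eq => i; rewrite !tnth_mktuple mevalZ mevalXU /=.
  have := mroots_coeff cs (lift ord0 i); rewrite /= /bump /= add1n => ->.
  by rewrite mulrA -exprMn mulN1r opprK expr1n mul1r.
exists [seq T e | e <- iota 0 (size coincidence_poly)] => cs.
rewrite -meval_coincidence_poly; split => [H | H U /mapP[e _ ->]].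
  apply/polyP => e; rewrite coef0 coef_map /= -TE.
  have [lt|le] := ltnP e (size coincidence_poly).
    by apply: H; apply: map_f; rewrite mem_iota.
  by rewrite TE nth_default // meval0.
by rewrite TE -coef_map H coef0.
Qed.

End RootCoincidences.

(** * Zariski-closed conditions *)

Section PolynomialFunctions.
Variables (K : fieldType) (n : nat).
Implicit Types (phi psi : ('I_n -> K) -> K) (Z : ('I_n -> K) -> Prop).

Definition polyfun phi := exists P : {mpoly K[n]}, forall x, P.@[x] = phi x.

Lemma polyfun_cst a : polyfun (fun=> a).
Proof. by exists a%:MP => x; rewrite mevalC. Qed.

Lemma polyfun_coord i : polyfun (fun x => x i).
Proof. by exists 'X_i => x; rewrite mevalXU. Qed.

Lemma polyfunM phi psi : polyfun phi -> polyfun psi -> polyfun (fun x => phi x * psi x).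
Proof. by case=> P hP [Q hQ]; exists (P * Q) => x; rewrite mevalM hP hQ. Qed.

Lemma polyfunX phi e : polyfun phi -> polyfun (fun x => phi x ^+ e).
Proof. by case=> P hP; exists (P ^+ e) => x; rewrite rmorphXn /= hP. Qed.

Lemma polyfun_sum (I : finType) (F : I -> ('I_n -> K) -> K) :
  (forall i, polyfun (F i)) -> polyfun (fun x => \sum_i F i x).
Proof.
move=> /fin_all_exists[P hP]; exists (\sum_i P i) => x.
by rewrite rmorph_sum; apply: eq_bigr => i _; apply: hP.
Qed.

Lemma polyfun_comp d (T : {mpoly K[d]}) (F : 'I_d -> ('I_n -> K) -> K) :
  (forall i, polyfun (F i)) -> polyfun (fun x => T.@[fun i => F i x]).
Proof.
move=> /fin_all_exists[P hP]; exists (T \mPo [tuple P i | i < d]) => x.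
by rewrite comp_mpoly_meval; apply: meval_eq => i; rewrite tnth_mktuple hP.
Qed.

Definition zariski_closed Z := exists s : seq {mpoly K[n]},
  forall x, (forall P, P \in s -> P.@[x] = 0) <-> Z x.

Lemma zariski_closed_eq phi psi :
  polyfun phi -> polyfun psi -> zariski_closed (fun x => phi x = psi x).
Proof.
case=> P hP [Q hQ]; exists [:: P - Q] => x; rewrite -hP -hQ; split=> [H|e U].
  by apply/eqP; rewrite -subr_eq0 -mevalB H ?mem_head.
by rewrite inE => /eqP ->; rewrite mevalB e subrr.
Qed.

Lemma zariski_closed_guard (b : bool) Z :
  zariski_closed Z -> zariski_closed (fun x => b /\ Z x).
Proof.
case: b => -[s hs]; first by exists s => x; rewrite hs; split=> [|[]].
exists [:: 1] => x; split=> [/(_ 1 (mem_head _ _))/eqP|[]//].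
by rewrite meval1 oner_eq0.
Qed.

Lemma zariski_closed_imp (b : bool) Z :
  zariski_closed Z -> zariski_closed (fun x => b -> Z x).
Proof.
case: b => -[s hs]; first by exists s => x; rewrite hs; split=> [|/(_ isT)].
by exists [::].
Qed.

Lemma zariski_closed_and Z1 Z2 :
  zariski_closed Z1 -> zariski_closed Z2 -> zariski_closed (fun x => Z1 x /\ Z2 x).
Proof.
case=> s1 h1 [s2 h2]; exists (s1 ++ s2) => x; rewrite -h1 -h2; split.
  by move=> H; split=> P Ps; apply: H; rewrite mem_cat Ps ?orbT.
by case=> H1 H2 P; rewrite mem_cat => /orP[]; [apply: H1 | apply: H2].
Qed.

Lemma zariski_closed_or Z1 Z2 :
  zariski_closed Z1 -> zariski_closed Z2 -> zariski_closed (fun x => Z1 x \/ Z2 x).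
Proof.
case=> s1 h1 [s2 h2]; exists [seq P * Q | P <- s1, Q <- s2] => x.
rewrite -h1 -h2; split; last first.
  move=> H U /allpairsP[[P Q] /= [Ps Qs ->]]; rewrite mevalM.
  by case: H => [/(_ P Ps)|/(_ Q Qs)] ->; rewrite ?mul0r ?mulr0.
move=> H; have [/allP a1|/allPn[P Ps nP]] := boolP (all (fun P => P.@[x] == 0) s1).
  by left => P /a1/eqP.
right=> Q Qs; have := H _ (allpairs_f (fun P Q => P * Q) Ps Qs).
by rewrite mevalM => /eqP; rewrite mulf_eq0 (negPf nP) => /eqP.
Qed.

Lemma zariski_closed_all_in (I : eqType) (r : seq I) (Z : I -> ('I_n -> K) -> Prop) :
  (forall i, zariski_closed (Z i)) -> zariski_closed (fun x => forall i, i \in r -> Z i x).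
Proof.
move=> cZ; elim: r => [|i r [s hs]]; first by exists [::].
have [t ht] := zariski_closed_and (cZ i) (ex_intro _ s hs).
exists t => x; rewrite ht; split=> [[Zi Zr] j|H].
  by rewrite inE => /predU1P[->|/Zr].
by split=> [|j jr]; apply: H; rewrite inE ?eqxx ?jr ?orbT.
Qed.

Lemma zariski_closed_all (I : finType) (Z : I -> ('I_n -> K) -> Prop) :
  (forall i, zariski_closed (Z i)) -> zariski_closed (fun x => forall i, Z i x).
Proof.
move=> /(zariski_closed_all_in (enum I))[s hs]; exists s => x; rewrite hs.
by split=> H i *; apply: H; rewrite mem_enum.
Qed.

Lemma zariski_closed_ex (I : finType) (Z : I -> ('I_n -> K) -> Prop) :
  (forall i, zariski_closed (Z i)) -> zariski_closed (fun x => exists i, Z i x).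
Proof.
move=> cZ.
suff [s hs] : zariski_closed (fun x => exists2 i, i \in enum I & Z i x).
  exists s => x; rewrite hs; split=> [[i _ Zi]|[i Zi]]; exists i => //.
  by rewrite mem_enum.
elim: (enum I) => [|i r [s hs]].
  exists [:: 1] => x; split=> [/(_ 1 (mem_head _ _))/eqP|[]//].
  by rewrite meval1 oner_eq0.
have [t ht] := zariski_closed_or (cZ i) (ex_intro _ s hs).
exists t => x; rewrite ht; split=> [[Zi|[j jr Zj]]|[j]].
- by exists i; rewrite ?mem_head.
- by exists j; rewrite // inE jr orbT.
- by rewrite inE => /predU1P[->|jr] Zj; [left | right; exists j].
Qed.

End PolynomialFunctions.

(** * Frobenius *)

Section IteratedFrobenius.
Variables (p : nat) (R : comNzRingType) (pR : p \in [pchar R]) (e : nat).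

(** The proof of [p \in [pchar R]] is an argument so that the morphism instances, which need it, can
    attach to [frobn]. *)
Definition frobn of p \in [pchar R] := fun x : R => x ^+ (p ^ e).

Let pnat_e : [pchar R].-nat (p ^ e)%N.
Proof. by rewrite pnatX pnatE ?pR // (pcharf_prime pR). Qed.

Lemma frobn_is_nmod_morphism : nmod_morphism (frobn pR).
Proof.
split=> [|x y]; last exact: exprDn_pchar.
by rewrite /frobn expr0n expn_eq0 -leqn0 leqNgt (prime_gt0 (pcharf_prime pR)).
Qed.

Lemma frobn_is_monoid_morphism : monoid_morphism (frobn pR).
Proof. by split=> [|x y]; rewrite /frobn ?expr1n ?exprMn. Qed.

HB.instance Definition _ := GRing.isNmodMorphism.Build R R (frobn pR) frobn_is_nmod_morphism.
HB.instance Definition _ := GRing.isMonoidMorphism.Build R R (frobn pR) frobn_is_monoid_morphism.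

End IteratedFrobenius.

Lemma expr_pexp_inj p (R : idomainType) (pR : p \in [pchar R]) e :
  injective (fun x : R => x ^+ (p ^ e)).
Proof.
move=> x y /= exy; apply/eqP; rewrite -subr_eq0.
have : (x - y) ^+ (p ^ e) == 0.
  by rewrite -[_ ^+ _]/(frobn e pR _) rmorphB /= /frobn exy subrr.
by rewrite expf_eq0 => /andP[].
Qed.

Section FrobeniusFixedPoints.
Variables (p : nat) (L : closedFieldType) (pL : p \in [pchar L]).

Let p_pr : prime p := pcharf_prime pL.

Lemma closed_field_root (n : nat) (x : L) : (0 < n)%N -> exists y, y ^+ n = x.
Proof.
move=> n0; have /closed_rootP[y] : size ('X^n - x%:P) != 1%N by rewrite size_XnsubC // eqSS -lt0n.
by rewrite rootE !hornerE subr_eq0 => /eqP; exists y.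
Qed.

(** [X^Q - X] splits over [L] and has derivative [-1], so its roots are distinct. *)
Lemma frobenius_fixed_points r : (0 < r)%N ->
  exists T : seq L, [/\ uniq T, size T = (p ^ r)%N & forall b, (b \in T) = (b ^+ (p ^ r) == b)].
Proof.
move=> r0; set Q := (p ^ r)%N; have Q1 : (1 < Q)%N by rewrite -(expn0 p) ltn_exp2l ?prime_gt1.
have sz : size ('X^Q - 'X : {poly L}) = Q.+1 by rewrite size_polyDl size_polyXn // size_polyN size_polyX.
have [T eT] := closed_field_poly_normal ('X^Q - 'X : {poly L}).
have lc : lead_coef ('X^Q - 'X : {poly L}) = 1.
  by rewrite lead_coefDl ?lead_coefXn // size_polyN size_polyX size_polyXn.
rewrite lc scale1r in eT; exists T; split.
- rewrite -separable_prod_XsubC -eT unlock derivB derivXn derivX.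
  have pP : p \in [pchar {poly L}] by rewrite pchar_poly.
  have -> : 'X^(Q.-1) *+ Q = 0 :> {poly L}.
    by rewrite -mulr_natr /Q natrX (pcharf0 pP) expr0n eqn0Ngt r0 mulr0.
  by rewrite sub0r -(scaleN1r 1) coprimepZr ?oppr_eq0 ?oner_eq0 ?coprimep1.
- by apply/eqP; rewrite -eqSS -(size_prod_XsubC _ id) -eT sz.
- by move=> b; rewrite -root_prod_XsubC -eT rootE !hornerE subr_eq0.
Qed.

Lemma poly_eq0_fixed_points r (P : {poly {poly L}}) : (0 < r)%N -> (size P <= p ^ r)%N ->
  (forall b : L, b ^+ (p ^ r) = b -> P.[b%:P] = 0) -> P = 0.
Proof.
move=> r0 sP H; have [T [uT sT TE]] := frobenius_fixed_points r0.
apply/eqP/contraT => nP.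
suff : (size [seq b%:P | b <- T] < size P)%N by rewrite size_map sT ltnNge sP.
apply: max_poly_roots => //; last by rewrite map_inj_uniq //; exact: polyC_inj.
by apply/allP => _ /mapP[b + ->]; rewrite TE rootE => /eqP/H ->.
Qed.

(** Only exponents divisible by [p] occur in [c], and the coefficients have [p]-th roots in [L]. *)
Lemma deriv_eq0_pth_power (c : {poly L}) : c^`() = 0 -> exists d, c = d ^+ p.
Proof.
move=> dc0; have /fin_all_exists[g gE] : forall i : 'I_(size c), exists y, y ^+ p = c`_(i * p).
  by move=> i; apply/closed_field_root/prime_gt0.
have pP : p \in [pchar {poly L}] by rewrite pchar_poly.
exists (\sum_(i < size c) (g i)%:P * 'X^i).
rewrite -[RHS]/(pFrobenius_aut pP _) rmorph_sum /=; under eq_bigr do rewrite pFrobenius_autE.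
apply/polyP => j; rewrite coef_sum.
have [/dvdnP[i ->]|npj] := boolP (p %| j)%N.
  have E (k : 'I_(size c)) : (((g k)%:P * 'X^k) ^+ p)`_(i * p) = if k == i :> nat then c`_(k * p) else 0.
    rewrite exprMn -exprM -rmorphXn /= coefCM coefXn gE eqn_pmul2r ?prime_gt0 //.
    by rewrite mulr_natr eq_sym; case: eqP.
  rewrite (eq_bigr _ (fun k _ => E k)) -big_mkcond /=.
  have [ilt|ige] := ltnP i (size c).
    by rewrite (big_pred1 (Ordinal ilt)).
  rewrite nth_default; last by rewrite (leq_trans ige) // leq_pmulr ?prime_gt0.
  by rewrite big1 // => k /eqP ik; move: (ltn_ord k); rewrite ik ltnNge ige.
rewrite big1 => [|k _]; last first.
  rewrite exprMn -exprM -rmorphXn /= coefCM coefXn.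
  by case: eqP => [ej|]; rewrite ?mulr0 //; move: npj; rewrite ej dvdn_mull.
move: npj; case: j => [|j npj]; first by rewrite dvdn0.
move: (congr1 (fun P : {poly L} => P`_j) dc0); rewrite coef_deriv coef0 -mulr_natr => /eqP.
by rewrite mulf_eq0 -(dvdn_pcharf pL) (negPf npj) orbF => /eqP.
Qed.

End FrobeniusFixedPoints.

(** * Descent along the derivation d/dt *)

Lemma horner_map_deriv (L : comNzRingType) (R : {poly {poly L}}) (b : L) :
  (map_poly (@deriv L) R).[b%:P] = (R.[b%:P])^`().
Proof.
rewrite (horner_coef_wide b%:P (size_poly _ _)) horner_coef raddf_sum /=.
apply: eq_bigr => i _; rewrite coef_map /= derivM -polyC_exp derivC mulr0 addr0.
by [].
Qed.

(** The leading coefficient [1] is killed by d/dt. This drop keeps the identity used in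
    [split_of_power_values] within size [p^w + p^(r-1) <= p^r], the number of nodes. *)
Lemma size_map_deriv_monic (L : comNzRingType) (R : {poly {poly L}}) :
  R \is monic -> (size (map_poly (@deriv L) R) <= (size R).-1)%N.
Proof.
move=> mR; apply/leq_sizeP => j jR; rewrite coef_map /=.
have [lt|le] := ltnP j (size R); last by rewrite nth_default ?deriv0.
have -> : j = (size R).-1 by lia.
by rewrite -/(lead_coef R) (monicP mR) derivC.
Qed.

Section Descent.
Variables (p : nat) (L : closedFieldType) (pL : p \in [pchar L]).
Variables (pP : p \in [pchar {poly L}]) (r : nat).
Hypothesis r0 : (0 < r)%N.

Let p_pr : prime p := pcharf_prime pL.

(* Differentiating [R(b) = (b^(p^w) - t)^nu] with respect to [t] turns the values of [R] at
   the [p^r] nodes into the polynomial identity [(X^(p^w) - t) R' + nu R = 0]. Either [p]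
   does not divide [nu] and a factor [X^(p^w) - t] splits off [R], or [R' = 0] and [R] is
   the Frobenius twist of a polynomial of the same kind. *)
Lemma split_of_power_values (nu w : nat) (R : {poly {poly L}}) :
  (w < r)%N -> R \is monic -> (size R <= (p ^ r.-1).+1)%N ->
  (forall b : L, b ^+ (p ^ r) = b -> R.[b%:P] = ((b ^+ (p ^ w))%:P - 'X) ^+ nu) ->
  exists fs : seq nat,
    [/\ map_poly (frobn r pP) R = \prod_(f <- fs) ('X - ('X^(p ^ f))%:P),
        forall f, f \in fs -> (r %| f + w)%N &
        (\sum_(f <- fs) p ^ f = nu * p ^ r)%N].
Proof.
have p1 := prime_gt1 p_pr; have p0 := prime_gt0 p_pr.
have pr1 : (p ^ r.-1 * 2 <= p ^ r)%N.
  by rewrite -[in leqRHS](prednK r0) expnSr leq_mul2l p1 orbT.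
have prgt0 : (0 < p ^ r.-1)%N by rewrite expn_gt0 p0.
elim/ltn_ind: nu w R => nu IH w R wr mR sR RE.
have sRQ : (size R <= p ^ r)%N by lia.
have [nu0|nu0] := posnP nu.
  exists [::]; rewrite !big_nil nu0; split => //.
  have -> : R = 1.
    apply/eqP; rewrite -subr_eq0; apply/eqP.
    apply: (poly_eq0_fixed_points pL r0) => [|b /RE bE].
      by rewrite (leq_trans (size_polyD _ _)) // geq_max sRQ size_polyN size_poly1; lia.
    by rewrite hornerD hornerN hornerC bE nu0 subrr.
  by rewrite rmorph1.
pose P : {poly {poly L}} := 'X^(p ^ w) - ('X)%:P.
have PE b : P.[b%:P] = (b ^+ (p ^ w))%:P - 'X by rewrite !hornerE polyC_exp.
have pw0 : (0 < p ^ w)%N by rewrite expn_gt0 p0.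
have sP : size P = (p ^ w).+1 by rewrite size_XnsubC.
have mP : P \is monic by rewrite monicXnsubC.
pose DR := map_poly (@deriv L) R.
have sDR : (size DR <= p ^ r.-1)%N.
  by apply: leq_trans (size_map_deriv_monic mR) _; rewrite -subn1 leq_subLR add1n.
have key : P * DR + nu%:R *: R = 0.
  apply: (poly_eq0_fixed_points pL r0).
    rewrite (leq_trans (size_polyD _ _)) // geq_max (leq_trans (size_scale_leq _ _)) // andbT.
    apply: leq_trans (size_polyMleq _ _) _; rewrite sP /=.
    have pwr : (p ^ w <= p ^ r.-1)%N by rewrite leq_exp2l //; lia.
    by apply: leq_trans (leq_add pwr sDR) _; rewrite addnn -muln2.
  move=> b /RE bE; rewrite hornerD hornerZ hornerM horner_map_deriv PE bE.
  rewrite deriv_exp derivB derivC derivX sub0r mulN1r mulNrn mulrN mulrnAr -exprS prednK //.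
  by rewrite mulr_natl addNr.
have [/dvdnP[nu' enu]|npnu] := boolP (p %| nu)%N; last first.
  have nun : (nu%:R : L) != 0 by rewrite -(dvdn_pcharf pL).
  pose R1 : {poly {poly L}} := (- (nu%:R : L)^-1)%:P *: DR.
  have RP : R = P * R1.
    have : nu%:R *: R = - (P * DR) by apply/eqP; rewrite -subr_eq0 opprK addrC key.
    move/(congr1 (fun U => (nu%:R : L)^-1%:P *: U)); rewrite scalerA -polyC_natr -polyCM mulVf //.
    by rewrite scale1r => ->; rewrite /R1 polyCN scaleNr mulrN scalerN scalerAr.
  have mR1 : R1 \is monic by rewrite -(monicMl _ mP) -RP.
  have [||b bE|fs [fsE fsw fss]] := IH nu.-1 _ w R1 wr mR1.
  - by rewrite prednK.
  - apply: leq_trans sR; have <- : size (P * R1) = size R by rewrite -RP.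
    by rewrite size_monicM ?monic_neq0 // sP addSn leq_addl.
  - have nP : P.[b%:P] != 0.
      by rewrite PE -opprB oppr_eq0 polyXsubC_eq0.
    by apply: (mulfI nP); rewrite -hornerM -RP RE // -PE -exprS prednK.
  (* The twist of [X^(p^w) - t] is [X^(p^w) - t^(p^r) = (X - t^(p^(r-w)))^(p^w)]. *)
  exists (nseq (p ^ w)%N (r - w)%N ++ fs); split.
  - rewrite big_cat /= big_nseq RP rmorphM /= fsE; congr (_ * _).
    rewrite /P rmorphB /= map_polyXn map_polyC /=.
    have pPP : p \in [pchar {poly {poly L}}] by rewrite pchar_poly.
    rewrite iter_mulr_1 -[RHS]/(frobn w pPP _) rmorphB /= /frobn -polyC_exp -!exprM -expnD.
    by rewrite subnK // ltnW.
  - move=> f; rewrite mem_cat mem_nseq => /orP[/andP[_ /eqP->]|/fsw//].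
    by rewrite subnK // ltnW.
  - rewrite big_cat /= big_nseq iter_addn_0 fss -expnD subnK ?(ltnW wr) //.
    by rewrite -mulSn prednK.
have DR0 : DR = 0.
  move: key; rewrite enu natrM (pcharf0 pP) mulr0 scale0r addr0.
  by move/eqP; rewrite mulf_eq0 (negPf (monic_neq0 mP)) => /eqP.
have /fin_all_exists[g gE] : forall i : 'I_(size R), exists d, R`_i = d ^+ p.
  move=> i; apply: (deriv_eq0_pth_power pL).
  by rewrite -(coef_map (@deriv L)) -/DR DR0 coef0.
pose F1 : {rmorphism {poly L} -> {poly L}} := pFrobenius_aut pP.
have [R1 RF] : exists R1, R = map_poly F1 R1.
  exists (\sum_(i < size R) (g i)%:P * 'X^i); rewrite rmorph_sum /=.
  rewrite -{1}[R]coefK poly_def; apply: eq_bigr => i _.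
  by rewrite rmorphM /= map_polyXn map_polyC /= gE mul_polyC.
have F1inj : injective F1 by move=> x y; rewrite /F1 /= !pFrobenius_autE -(expn1 p); exact: expr_pexp_inj.
have sR1 : size R1 = size R.
  by rewrite RF (size_map_inj_poly F1inj (rmorph0 F1)).
have mR1 : R1 \is monic.
  move: mR; rewrite !monicE !lead_coefE RF coef_map /= (size_map_inj_poly F1inj (rmorph0 F1)) -[X in _ == X -> _](rmorph1 F1).
  by move/eqP/F1inj ->.
have nu'0 : (0 < nu')%N by move: nu0; rewrite enu muln_gt0 => /andP[].
have nu'lt : (nu' < nu)%N by rewrite enu ltn_Pmulr.
(* Since [R1(b)^p = R(b^p)], the node now enters through [b^(p^(w+1))]; the exponent is reduced
   modulo [r] because [b^(p^r) = b]. *)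
pose w' := (w.+1 %% r)%N.
have w'r : (w' < r)%N by rewrite ltn_mod.
have [|b bE|fs [fsE fsw fss]] := IH nu' nu'lt w' R1 w'r mR1.
- by rewrite sR1.
- apply: F1inj; rewrite -horner_map -RF /F1 /= !pFrobenius_autE -polyC_exp RE; last first.
    by rewrite exprAC bE.
  rewrite enu exprM; congr ((_%:P - _) ^+ _ ^+ _); rewrite -exprM -expnS /w'.
  by move: wr; rewrite leq_eqVlt => /predU1P[->|/modn_small->//]; rewrite modnn bE expr1.
exists [seq f.+1 | f <- fs]; split.
- rewrite RF big_map -map_poly_comp_id0 ?rmorph0 //.
  transitivity (map_poly F1 (map_poly (frobn r pP) R1)).
    rewrite -map_poly_comp_id0 ?rmorph0 //; apply: eq_map_poly => x /=.
    by rewrite /F1 /= !pFrobenius_autE /frobn exprAC.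
  rewrite fsE rmorph_prod /=; apply: eq_bigr => f _.
  by rewrite rmorphB /= map_polyX map_polyC /= /F1 /= pFrobenius_autE -exprM -expnSr.
- move=> _ /mapP[f /fsw ff ->]; move: ff.
  by rewrite /dvdn modnDmr addSnnS.
- rewrite big_map enu -mulnA [(p * _)%N]mulnC mulnA -fss big_distrl /=.
  by apply: eq_bigr => f _; rewrite expnSr.
Qed.

End Descent.

(** * Interpolation *)

Section Interpolation.
Variables (L : fieldType) (Q : nat) (beta : 'I_Q -> L).
Hypothesis beta_inj : injective beta.

Definition lagrange_poly (i : 'I_Q) : {poly L} :=
  \prod_(j | j != i) ((beta i - beta j)^-1 *: ('X - (beta j)%:P)).

Lemma lagrange_polyE i j : (lagrange_poly i).[beta j] = (i == j)%:R.
Proof.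
rewrite horner_prod; have [<-|nij] := eqVneq i j.
  rewrite big1 // => k nki; rewrite !hornerE mulVf // subr_eq0.
  by apply: contra nki => /eqP /beta_inj ->.
by rewrite (bigD1 j) 1?eq_sym //= !hornerE subrr mulr0 mul0r.
Qed.

Lemma size_lagrange_poly i : (size (lagrange_poly i) <= Q)%N.
Proof.
apply: leq_trans (size_prod_leq _ _) _ => /=.
have : (\sum_(j < Q | j != i) size ((beta i - beta j)^-1 *: ('X - (beta j)%:P)) <=
        \sum_(j < Q | j != i) 2)%N.
  by apply: leq_sum => j _; apply: leq_trans (size_scale_leq _ _) _; rewrite size_XsubC.
rewrite sum_nat_const => /leq_ltn_trans; have c1 : #|[pred j | j != i]| = Q.-1.
  by rewrite (@eq_card _ _ (predC1 i)) // cardC1 card_ord.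
rewrite c1; have := ltn_ord i; move: (\sum_(_ | _) _)%N => S iQ H.
have : (S < (Q.-1 * 2).+1)%N by apply: H.
lia.
Qed.

(** The coefficients are linear in [y] with constants from [L]. The ring [A] is [{poly L}] when
    derivatives are taken, and a field containing it when the values come from torus coordinates. *)
Definition interp (A : comNzRingType) (phi : {rmorphism L -> A}) (y : 'I_Q -> A) : {poly A} :=
  \sum_i y i *: map_poly phi (lagrange_poly i).

Lemma coef_interp (A : comNzRingType) (phi : {rmorphism L -> A}) y e :
  (interp phi y)`_e = \sum_i y i * phi (lagrange_poly i)`_e.
Proof. by rewrite coef_sum; apply: eq_bigr => i _; rewrite coefZ coef_map. Qed.

Lemma horner_interp (A : comNzRingType) (phi : {rmorphism L -> A}) y j :
  (interp phi y).[phi (beta j)] = y j.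
Proof.
rewrite horner_sum (bigD1 j) //= big1 => [|i nij].
  by rewrite hornerZ horner_map /= lagrange_polyE eqxx rmorph1 mulr1 addr0.
by rewrite hornerZ horner_map /= lagrange_polyE (negPf nij) rmorph0 mulr0.
Qed.

Lemma size_interp (A : comNzRingType) (phi : {rmorphism L -> A}) y :
  (size (interp phi y) <= Q)%N.
Proof.
apply: leq_trans (size_sum _ _ _) _; apply/bigmax_leqP => i _.
apply: leq_trans (size_scale_leq _ _) _; apply: leq_trans (size_poly _ _) _.
exact: size_lagrange_poly.
Qed.

Lemma map_interp (A B : comNzRingType) (phi : {rmorphism L -> A}) (psi : {rmorphism L -> B})
    (f : {rmorphism A -> B}) y : (forall x, psi x = f (phi x)) ->
  map_poly f (interp phi y) = interp psi (f \o y).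
Proof.
move=> psiE; apply/polyP => e; rewrite coef_map /= !coef_interp rmorph_sum.
by apply: eq_bigr => i _; rewrite rmorphM psiE.
Qed.

Lemma eq_interp (A : comNzRingType) (phi : {rmorphism L -> A}) y z :
  y =1 z -> interp phi y = interp phi z.
Proof. by move=> yz; apply: eq_bigr => i _; rewrite yz. Qed.

Lemma interp_uniq (A : idomainType) (phi : {rmorphism L -> A}) y (P : {poly A}) :
  (size P <= Q)%N -> (forall j, P.[phi (beta j)] = y j) -> P = interp phi y.
Proof.
move=> sP PE; apply/eqP; rewrite -subr_eq0; apply/contraT => nD.
suff : (size [seq phi (beta j) | j <- enum 'I_Q] < size (P - interp phi y)%R)%N.
  rewrite size_map size_enum_ord ltnNge => /negP[].
  by rewrite (leq_trans (size_polyD _ _)) // size_polyN geq_max sP size_interp.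
apply: max_poly_roots => //.
  by apply/allP => _ /mapP[j _ ->]; rewrite rootE hornerD hornerN PE horner_interp subrr.
by rewrite map_inj_uniq ?enum_uniq // => i j /fmorph_inj/beta_inj.
Qed.

(* If the values are [(b_i - t)^(-mu)] then every coefficient of the interpolant vanishes at
   [t = oo]; here this is seen by clearing denominators and evaluating at each [t = b_i]. *)
Lemma interp_inv_not_monic (F : fieldType) (phi : {rmorphism L -> F})
    (iota : {rmorphism {poly L} -> F}) (b : 'I_Q -> L) (mu : nat) (y : 'I_Q -> F) :
  injective iota -> (forall x, phi x = iota x%:P) -> injective b -> (0 < mu)%N ->
  (forall i, y i * iota ((b i)%:P - 'X) ^+ mu = 1) -> interp phi y \isn't monic.
Proof.
move=> iota_inj phiE b_inj mu0 yE; apply/negP => mon.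
pose g i : {poly L} := ((b i)%:P - 'X) ^+ mu.
pose co i := (lagrange_poly i)`_(size (interp phi y)).-1.
have key : \prod_i g i = \sum_i (\prod_(j | j != i) g j) * (co i)%:P.
  apply: iota_inj; rewrite -[LHS]mulr1 -(monicP mon) lead_coefE coef_interp rmorph_sum.
  rewrite big_distrr; apply: eq_bigr => i _ /=; rewrite (bigD1 i) //= !rmorphM /= phiE.
  by rewrite mulrACA [_ * y i]mulrC rmorphXn /= yE mul1r.
have gE i j : (g j).[b i] = (b j - b i) ^+ mu by rewrite !hornerE.
have co0 i : co i = 0.
  move/(congr1 (fun P : {poly L} => P.[b i])): key.
  rewrite (bigD1 i) //= hornerM gE subrr expr0n eqn0Ngt mu0 mul0r.
  rewrite horner_sum (bigD1 i) //= [X in _ + X]big1 ?addr0 => [/esym/eqP|j nji].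
    rewrite hornerM hornerC mulf_eq0 horner_prod => /orP[/prodf_eq0[j nji]|/eqP//].
    by rewrite gE expf_eq0 subr_eq0 mu0 (inj_eq b_inj) (negPf nji).
  by rewrite (bigD1 i) 1?eq_sym //= !hornerM gE subrr expr0n eqn0Ngt mu0 !mul0r.
move/eqP: key; rewrite [X in _ == X]big1 => [|i _]; last by rewrite co0 mulr0.
move/prodf_eq0 => [i _]; rewrite expf_eq0 mu0 -opprB oppr_eq0.
by rewrite polyXsubC_eq0.
Qed.

End Interpolation.

(** * An orbit on the torus *)

Section TorusOrbit.
Variables (K : fieldType) (Q H : nat) (u : 'I_Q -> K).
Hypothesis u0 : forall i, u i != 0.

Local Notation d := #|{: 'I_Q * 'I_H.+1}|.

Lemma monomial_Gm_endo n (sigma : 'I_n -> 'I_n) (a : 'I_n -> K) :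
  (forall i, a i != 0) -> Gm_endo (fun x i => a i * x (sigma i)).
Proof.
move=> a0; exists (fun i => a i *: 'X_(sigma i)), (fun=> 0%MM); split.
  move=> i; exists (a i)^-1%:MP, U_(sigma i)%MM.
  by rewrite mulrC mul_mpolyC scalerA mulVf // scale1r.
by move=> x _ i; rewrite mevalZ mevalXU mpolyX0 meval1 divr1.
Qed.

Definition carry_shift (c : 'I_d) : 'I_d :=
  let: (i, h) := enum_val c in
  enum_rank (i, if (h < H)%N then inord h.+1 else ord0).

Definition carry_weight (c : 'I_d) : K :=
  let: (i, h) := enum_val c in if (h < H)%N then 1 else u i.

(* After [n] steps the coordinate [(i, h)] holds [u_i] to the power [(n + h) / (H + 1)]:
   a translation by [u] spread over [H + 1] steps, which keeps track of [n] modulo [H + 1]. *)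
Definition carry_endo (x : 'I_d -> K) : 'I_d -> K :=
  fun c => carry_weight c * x (carry_shift c).

Definition carry_orbit (n : nat) (c : 'I_d) : K :=
  u (enum_val c).1 ^+ ((n + (enum_val c).2) %/ H.+1).

Lemma iter_carry_endo n : iter n carry_endo (fun=> 1) =1 carry_orbit n.
Proof.
elim: n => [|n IH] c; rewrite /carry_orbit.
  by rewrite add0n divn_small.
rewrite iterS [LHS]/carry_endo IH /carry_orbit /carry_weight /carry_shift.
case: (enum_val c) => i h; rewrite enum_rankK /=; have := ltn_ord h; rewrite ltnS => hH.
have [lt|ge] := ltnP h H; first by rewrite mul1r inordK // addnS.
have -> : h = H :> nat by apply/eqP; rewrite eqn_leq hH.
by rewrite addn0 -exprS addSnnS divnDr // divnn addn1.
Qed.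

Lemma DML_set_carry_orbit (Z : ('I_d -> K) -> Prop) (S : nat -> Prop) :
  (0 < Q)%N -> zariski_closed Z ->
  (forall n, S n <-> Z (carry_orbit n)) -> DML_set_split_torus K S.
Proof.
(* The orbit is known only pointwise; a zero set respects pointwise equality. *)
move=> Q0 [s hs] SZ; have extZ x y : x =1 y -> Z x -> Z y.
  by move=> xy /hs Zx; apply/hs => P Ps; rewrite -(meval_eq P xy) Zx.
exists d; split.
  by rewrite card_prod !card_ord muln_gt0 Q0.
exists carry_endo, (fun=> 1), s; split; [|split] => [|i|n].
- apply: monomial_Gm_endo => c; rewrite /carry_weight; case: (enum_val c) => i h.
  by case: ifP => _; rewrite ?oner_eq0.
- exact: oner_neq0.
- have E := iter_carry_endo n; rewrite SZ; split=> [Zn|[_ /hs Zn]].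
    split; first by move=> c; rewrite E expf_neq0.
    by apply/hs; apply: extZ Zn => c; rewrite E.
  exact: extZ Zn.
Qed.

Lemma carry_orbitE n i h : carry_orbit n (enum_rank (i, h)) = u i ^+ ((n + h) %/ H.+1).
Proof. by rewrite /carry_orbit enum_rankK. Qed.

End TorusOrbit.

(** Adding [h] to [n] carries into the quotient exactly when [h >= H.+1 - n %% H.+1], so the carries
    determine the residue. They are visible in the powers of [v], which is not a root of unity. *)
Lemma carry_pattern_mod (K : fieldType) (v : K) (H n e : nat) :
  v != 0 -> (forall a, v ^+ a = 1 -> a = 0%N) -> (e < H.+1)%N ->
  (forall h : 'I_H.+1, v ^+ ((n + h) %/ H.+1) = v ^+ ((e + h) %/ H.+1) * v ^+ (n %/ H.+1))
  <-> (n %% H.+1)%N = e.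
Proof.
move=> v0 v1 eH; have expv_inj a b : v ^+ a = v ^+ b -> a = b.
  wlog ab : a b / (a <= b)%N => [W|].
    by case/orP: (leq_total a b) => ab E; [|apply/esym]; apply: W.
  rewrite -{1}(subnK ab) exprD -{1}[v ^+ a]mul1r => /esym/(mulIf (expf_neq0 _ v0))/v1.
  by lia.
have divE h : ((n + h) %/ H.+1 = n %/ H.+1 + (n %% H.+1 + h) %/ H.+1)%N.
  by rewrite {1}(divn_eq n H.+1) -addnA divnMDl.
split=> [E|<- h]; last by rewrite divE exprD mulrC.
have {}E (h : 'I_H.+1) : ((n %% H.+1 + h) %/ H.+1 = (e + h) %/ H.+1)%N.
  have := E h; rewrite divE exprD mulrC => /(mulIf (expf_neq0 _ v0)).
  exact: expv_inj.
have fH := ltn_pmod n (ltn0Sn H); move: (n %% H.+1)%N fH E => f fH E.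
(* The least [h] at which the larger residue carries separates the two. *)
have [lt|lt|//] := ltngtP f e.
  have eH' : (H.+1 - e < H.+1)%N by lia.
  have := E (Ordinal eH'); rewrite /= subnKC ?(ltnW eH) // divnn divn_small //; lia.
have fH' : (H.+1 - f < H.+1)%N by lia.
have := E (Ordinal fH'); rewrite /= subnKC ?(ltnW fH) // divnn divn_small //; lia.
Qed.

(** * Blocks of equal roots *)

Section Blocks.
Variables (J : eqType) (bs : seq J).

(** Serves as the map [pi] of [root_coincidence_closed]: equating each position with the first one
    of its label makes the roots constant on blocks. *)
Definition first_index (i : 'I_(size bs)) : 'I_(size bs) :=
  insubd i (index (tnth (in_tuple bs) i) bs).

Lemma val_first_index i : first_index i = index (tnth (in_tuple bs) i) bs :> nat.
Proof. by rewrite val_insubd index_mem mem_tnth. Qed.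

Lemma tnth_first_index i : tnth (in_tuple bs) (first_index i) = tnth (in_tuple bs) i.
Proof.
rewrite (tnth_nth (tnth (in_tuple bs) i)) /= val_first_index nth_index //.
exact: mem_tnth.
Qed.

Lemma big_first_index (fs : (size bs).-tuple nat) (s : 'S_(size bs)) (F : nat -> nat) :
  (forall i, tnth fs (s i) = tnth fs (s (first_index i))) ->
  exists g : J -> nat, (forall b, b \in bs -> g b \in val fs) /\
    (\sum_(f <- fs) F f = \sum_(b <- bs) F (g b))%N.
Proof.
move=> fsE; pose g b := if insub (index b bs) is Some i then tnth fs (s i) else 0%N.
have gE i : g (tnth (in_tuple bs) i) = tnth fs (s i).
  rewrite /g; case: insubP => [j _ jE|]; last by rewrite index_mem mem_tnth.
  by rewrite [RHS]fsE; congr (tnth fs (s _)); apply: val_inj; rewrite jE [RHS]val_first_index.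
exists g; split=> [b bbs|].
  by have /tnthP[i ->] : b \in in_tuple bs by []; rewrite gE mem_tnth.
rewrite big_tuple (reindex_inj (@perm_inj _ s)) /= [RHS]big_tnth.
by apply: eq_bigr => i _; rewrite gE.
Qed.

End Blocks.

Section BlockSeq.
Variables (J : finType) (A : {set J}) (mult : J -> nat).

Definition block_seq : seq J := flatten [seq nseq (mult j) j | j <- enum A].

Lemma mem_block_seq j : (j \in block_seq) = (j \in A) && (0 < mult j)%N.
Proof.
apply/flatten_mapP/andP => [[i + /nseqP[-> ?]]|[jA mj]]; first by rewrite mem_enum.
by exists j; rewrite ?mem_enum // mem_nseq mj eqxx.
Qed.

Lemma sum_block_seq (F : J -> nat) :
  (\sum_(j <- block_seq) F j = \sum_(j in A) mult j * F j)%N.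
Proof.
rewrite big_flatten big_map big_enum /=; apply: eq_bigr => j _.
by rewrite big_nseq iter_addn_0 mulnC.
Qed.

Lemma size_block_seq : size block_seq = (\sum_(j in A) mult j)%N.
Proof.
by rewrite -sum1_size sum_block_seq; apply: eq_bigr => j _; rewrite muln1.
Qed.

Lemma prod_block_seq (R : comNzRingType) (F : J -> R) :
  \prod_(j <- block_seq) F j = \prod_(j in A) F j ^+ mult j.
Proof.
rewrite big_flatten big_map big_enum /=; apply: eq_bigr => j _.
by rewrite big_nseq iter_mulr_1.
Qed.

End BlockSeq.

Lemma exp_XsubC (p n : nat) (A : comNzRingType) (x : A) : p \in [pchar A] ->
  ('X - x%:P) ^+ (p ^ n) = 'X^(p ^ n) - (x ^+ (p ^ n))%:P.
Proof.
move=> pA; have pPA : p \in [pchar {poly A}] by rewrite pchar_poly.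
by rewrite -[LHS]/(frobn n pPA _) rmorphB /= /frobn polyC_exp.
Qed.

(** Turns being monic of degree [D] into finitely many equations on coefficients, a closed
    condition. *)
Lemma monic_of_coef (A : nzRingType) (R : {poly A}) (D Q : nat) :
  (size R <= Q)%N -> (D < Q)%N ->
  (forall e : 'I_Q, (D <= e)%N -> R`_e = (e == D :> nat)%:R) <->
  (R \is monic /\ size R = D.+1).
Proof.
move=> sR DQ; split=> [RE|[mR sRE] e De]; last first.
  have [->|neD] := eqVneq (e : nat) D; last by rewrite nth_default // sRE; lia.
  by move: (monicP mR); rewrite lead_coefE sRE.
have RD : R`_D = 1 by rewrite (RE (Ordinal DQ)) //= eqxx.
suff sRE : size R = D.+1 by rewrite monicE lead_coefE sRE /= RD eqxx.
apply/eqP; rewrite eqn_leq; apply/andP; split; last first.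
  by rewrite ltnNge; apply/negP => /leq_sizeP/(_ D (leqnn _))/eqP; rewrite RD oner_eq0.
apply/leq_sizeP => j Dj; have [jQ|Qj] := ltnP j Q.
  by rewrite (RE (Ordinal jQ)) ?(ltnW Dj) //= gtn_eqF.
by rewrite nth_default // (leq_trans sR).
Qed.

(** * Interpolation of powers of [b - t] at the Frobenius fixed points *)

Section Nodes.
Variables (p : nat) (L : closedFieldType) (pL : p \in [pchar L]).
Variables (K : fieldType) (iota : {rmorphism {poly L} -> K}).
Hypothesis iota_inj : injective iota.
Variables (r : nat) (b : 'I_(p ^ r) -> L).
Hypothesis r0 : (0 < r)%N.
Hypothesis b_inj : injective b.
Hypothesis b_fix : forall i, b i ^+ (p ^ r) = b i.
Hypothesis b_surj : forall x, x ^+ (p ^ r) = x -> exists i, b i = x.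

Let p_pr : prime p := pcharf_prime pL.
Let pP : p \in [pchar {poly L}]. Proof. by rewrite pchar_poly. Qed.

(** For [w <= r] the [p^w]-th power of this node is [b i]. Hence [power_interp] takes the value
    [(x^(p^w) - t)^nu] at the node [x], as [split_of_power_values] requires. *)
Definition twisted_node (w : nat) (i : 'I_(p ^ r)) : L := b i ^+ (p ^ (r - w)).

Lemma twisted_node_inj w : injective (twisted_node w).
Proof. by move=> i j /(expr_pexp_inj pL)/b_inj. Qed.

Definition power_interp w nu : {poly {poly L}} :=
  interp (twisted_node w) (@polyC L) (fun i => ((b i)%:P - 'X) ^+ nu).

(** The twisted polynomial has roots [t^(p^f)] by [split_of_power_values], and the equations [Ts]
    make them agree along blocks, up to a permutation. Hence each label has one exponent. *)
Lemma power_interp_blocks (J : eqType) (bs : seq J) w nu (Ts : seq {mpoly K[size bs]}) :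
  (forall cs : (size bs).-tuple K,
    (forall T, T \in Ts -> T.@[fun i : 'I_(size bs) => (\prod_(c <- cs) ('X - c%:P))`_i] = 0)
    <-> exists s : 'S_(size bs), forall i, tnth cs (s i) = tnth cs (s (first_index i))) ->
  (w < r)%N -> (size bs <= p ^ r.-1)%N ->
  power_interp w nu \is monic -> size (power_interp w nu) = (size bs).+1 ->
  (forall T, T \in Ts ->
    T.@[fun i : 'I_(size bs) => iota (power_interp w nu)`_i ^+ (p ^ r)] = 0) ->
  exists g : J -> nat, (forall j, j \in bs -> r %| g j + w)%N /\
    (\sum_(j <- bs) p ^ g j = nu * p ^ r)%N.
Proof.
set R := power_interp w nu => TsE wr szbs mR sR HT.
have [|x xE|fs [fsE fsw fss]] := split_of_power_values pL pP r0 wr mR (nu := nu).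
- by rewrite sR.
- have xwE : (x ^+ (p ^ w)) ^+ (p ^ r) = x ^+ (p ^ w) by rewrite exprAC xE.
  have [i bi] := b_surj xwE.
  have -> : x = twisted_node w i.
    by rewrite /twisted_node bi -exprM -expnD subnKC ?(ltnW wr).
  rewrite (horner_interp (@twisted_node_inj w)) /twisted_node -exprM -expnD subnK ?(ltnW wr) //.
  by rewrite b_fix.
have szfs : size fs == size bs.
  rewrite -eqSS -(size_prod_XsubC fs (fun f => 'X^(p ^ f) : {poly L})) -fsE -sR.
  by rewrite (size_map_inj_poly _ (rmorph0 _)) //; exact: expr_pexp_inj.
pose ft := Tuple szfs; pose cs := map_tuple (fun f => iota 'X^(p ^ f)) ft.
have csE : \prod_(c <- cs) ('X - c%:P) = map_poly iota (map_poly (frobn r pP) R).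
  rewrite fsE rmorph_prod big_map; apply: eq_bigr => f _.
  by rewrite rmorphB /= map_polyX map_polyC.
have [s sE] : exists s : 'S_(size bs), forall i, tnth cs (s i) = tnth cs (s (first_index i)).
  apply/TsE => T /HT TE; rewrite -[RHS]TE; apply: meval_eq => i.
  by rewrite csE !coef_map /= rmorphXn.
have ftE i : tnth ft (s i) = tnth ft (s (first_index i)).
  have := sE i; rewrite !tnth_map => /iota_inj/(congr1 (fun P : {poly L} => size P)).
  by rewrite !size_polyXn => -[] /(expnI (prime_gt1 p_pr)).
have [g [gfs gE]] := big_first_index (expn p) ftE.
by exists g; rewrite -gE fss; split=> // j /gfs/fsw.
Qed.

(** With [q = p^k], the interpolant is [prod_j (X^(q^sigma_j) - t^(q^e_j))^c_j]: as
    [sigma_j = e_j + w] modulo [N], the twisted node to the power [q^sigma_j] is [b_i^(q^e_j)], and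
    the factor of [j] takes the value [(b_i - t)^(c_j q^e_j)]. *)
Lemma power_interp_sum (k N w nu : nat) (J : finType) (A : {set J}) (c sigma e : J -> nat) :
  r = (k * N)%N -> (w < N)%N -> (forall j, j \in A -> sigma j = (e j + w) %% N)%N ->
  nu = (\sum_(j in A) c j * (p ^ k) ^ e j)%N ->
  (size (block_seq A (fun j => c j * (p ^ k) ^ sigma j)) <= p ^ r.-1)%N ->
  power_interp (k * w) nu \is monic /\
  map_poly (frobn r pP) (power_interp (k * w) nu) =
    \prod_(j <- block_seq A (fun j => c j * (p ^ k) ^ sigma j)%N)
      ('X - ('X^(p ^ (k * (e j + N - sigma j))))%:P).
Proof.
move=> rE wN sigmaE nuE szbs.
have [k0 N0] : (0 < k /\ 0 < N)%N by move: r0; rewrite rE muln_gt0 => /andP.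
have p0 := prime_gt0 p_pr.
have sigN j : j \in A -> (sigma j < N)%N by move/sigmaE ->; rewrite ltn_mod.
pose R : {poly {poly L}} := \prod_(j in A) ('X^(p ^ (k * sigma j)) - ('X^(p ^ (k * e j)))%:P) ^+ c j.
have RF : map_poly (frobn r pP) R =
    \prod_(j <- block_seq A (fun j => c j * (p ^ k) ^ sigma j)%N)
      ('X - ('X^(p ^ (k * (e j + N - sigma j))))%:P).
  rewrite prod_block_seq rmorph_prod; apply: eq_bigr => j jA.
  rewrite rmorphXn [(c j * _)%N]mulnC [RHS]exprM; congr (_ ^+ c j).
  rewrite -expnM exp_XsubC // rmorphB /= map_polyXn map_polyC /= /frobn -!exprM -!expnD.
  by rewrite -mulnDr subnK ?mulnDr ?rE // (leq_trans (ltnW (sigN j jA))) // leq_addl.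
have sR : size R = (size (block_seq A (fun j => c j * (p ^ k) ^ sigma j)%N)).+1.
  rewrite -(size_map_inj_poly _ (rmorph0 (frobn r pP))) ?RF ?size_prod_XsubC //.
  exact: expr_pexp_inj.
have mR : R \is monic.
  by apply: monic_prod => j _; rewrite monic_exp // monicXnsubC // expn_gt0 p0.
suff -> : power_interp (k * w) nu = R by [].
apply/esym/(interp_uniq (@twisted_node_inj _)).
  rewrite sR; apply: leq_ltn_trans szbs _.
  by rewrite ltn_exp2l ?prime_gt1 // prednK.
move=> i; rewrite horner_prod nuE expr_sum; apply: eq_bigr => j jA.
rewrite horner_exp [(c j * _)%N]mulnC [RHS]exprM; congr (_ ^+ c j).
rewrite -expnM -[RHS]/(frobn (k * e j) pP _) rmorphB /= /frobn -polyC_exp !hornerE /=.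
rewrite -polyC_exp /twisted_node -exprM -expnD; congr (_%:P - _).
have b_fixn t : b i ^+ (p ^ (r * t)) = b i.
  by elim: t => [|t IH]; rewrite ?muln0 ?expr1 // mulnS expnD exprM b_fix.
(* Inserting [(e j + w) %/ N] Frobenius periods makes the exponents equal up to one further
   period. *)
rewrite -{1}(b_fixn ((e j + w) %/ N)%N) -exprM -expnD.
have -> : (r * ((e j + w) %/ N) + (r - k * w + k * sigma j) = r * 1 + k * e j)%N.
  have := divn_eq (e j + w) N; rewrite -(sigmaE j jA) rE; move: (_ %/ _)%N => t et.
  rewrite -mulnBr -mulnDr -!mulnA -!mulnDr; congr (k * _)%N.
  by move: (wN) et; rewrite [(t * N)%N]mulnC; lia.
by rewrite expnD exprM b_fixn.
Qed.

End Nodes.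

(** * The closed sets *)

Section Pieces.
Variables (p k : nat) (L : closedFieldType) (pL : p \in [pchar L]).
Variables (K : fieldType) (iota : {rmorphism {poly L} -> K}).
Hypothesis iota_inj : injective iota.
Variables (m : nat) (c : 'I_m -> nat).
Hypothesis k0 : (0 < k)%N.
Hypothesis c0 : (forall j, 0 < c j)%N.

Let p_pr : prime p := pcharf_prime pL.
Let pP : p \in [pchar {poly L}]. Proof. by rewrite pchar_poly. Qed.
Let q := (p ^ k)%N.
(** Since [l <= q^l], the loss [l * #|A|] in [dvdn_sum_pow_gap] is at most [h]. The torus counts
    modulo [H.+1 = q^h], and [N] is the period in [exists_rotation]. *)
Let l := (\sum_j c j)%N.
Let h := (l * m)%N.
Let H := (q ^ h).-1.
Let N := (m * l).+1.
Let r := (k * N)%N.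

Variable b : 'I_(p ^ r) -> L.
Hypothesis b_inj : injective b.
Hypothesis b_fix : forall i, b i ^+ (p ^ r) = b i.
Hypothesis b_surj : forall x, x ^+ (p ^ r) = x -> exists i, b i = x.

Let u i := iota ((b i)%:P - 'X).

Let r0 : (0 < r)%N. Proof. by rewrite muln_gt0 k0. Qed.
Let q1 : (1 < q)%N. Proof. by rewrite -(expn0 p) ltn_exp2l ?prime_gt1. Qed.
Let q0 : (0 < q)%N. Proof. exact: ltnW. Qed.
Let HE : H.+1 = (q ^ h)%N. Proof. by rewrite prednK // expn_gt0 q0. Qed.
Let qN : (q ^ N)%N = (p ^ r)%N. Proof. by rewrite -expnM. Qed.

Let u0 i : u i != 0.
Proof.
by rewrite /u -(rmorph0 iota) (inj_eq iota_inj) -opprB oppr_eq0 polyXsubC_eq0.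
Qed.

Let u1 i a : u i ^+ a = 1 -> a = 0%N.
Proof.
rewrite -rmorphXn -(rmorph1 iota) => /iota_inj /(congr1 (fun P : {poly L} => (size P).-1)).
by rewrite size_exp -opprB size_polyN size_XsubC size_poly1 mul1n.
Qed.

(* A representation [n = sum_j c_j q^(n_j)] is classified by the set [A] of the [j] with
   [n_j >= h], the values [v_j = n_j] for the other [j], and the residues [sigma_j] modulo [N]
   of the [n_j - h + w], where the rotation [w] makes all [sigma_j] small enough for the
   interpolating polynomial to have degree at most [p^(r-1)]. *)
Lemma piece_closed (A : {set 'I_m}) (v : 'I_m -> nat) (sigma : 'I_m -> nat) (w : nat) :
  (w < N)%N ->
  let bs := block_seq A (fun j => c j * q ^ sigma j)%N in
  exists Z : ('I_#|{: 'I_(p ^ r) * 'I_H.+1}| -> K) -> Prop,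
  [/\ zariski_closed Z,
      forall n, Z (@carry_orbit K (p ^ r)%N H u n) -> B_set q c n &
      forall n (e : 'I_m -> nat), n = (\sum_j c j * q ^ e j)%N ->
        (forall j, j \notin A -> e j = v j) ->
        (forall j, j \in A -> (h <= e j)%N /\ sigma j = ((e j - h + w) %% N)%N) ->
        (size bs <= p ^ r.-1)%N -> Z (@carry_orbit K (p ^ r)%N H u n)].
Proof.
move=> wN bs; have p1 := prime_gt1 p_pr; have p0 := prime_gt0 p_pr.
have [Ts TsE] := root_coincidence_closed K (@first_index _ bs).
(* The terms outside [A] sum to [s]; the others should sum to [nu * q^h] with
   [nu = n %/ q^h - d]. *)
pose s := (\sum_(j | j \notin A) c j * q ^ v j)%N.
pose e := (s %% H.+1)%N; pose d := (s %/ H.+1)%N.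
have Q0 : (0 < p ^ r)%N by rewrite expn_gt0 p0.
pose i0 := Ordinal Q0.
pose phi : {rmorphism L -> K} := iota \o @polyC L.
pose beta := twisted_node b (k * w).
have beta_inj : injective beta by apply: twisted_node_inj.
(* On the orbit this is [u_i^nu], where [nu] may still be negative. *)
pose y (x : 'I_#|{: 'I_(p ^ r) * 'I_H.+1}| -> K) i := x (enum_rank (i, ord0)) * (u i)^-1 ^+ d.
pose R x := interp beta phi (y x).
(* The clauses: the degree fits, [n] is [s] modulo [q^h], the interpolant is monic of degree
   [size bs], its roots coincide in blocks. The power [p^r] of the coefficients is the twist after
   which the roots are natural powers of [t]. *)
pose Z x := (size bs <= p ^ r.-1)%N /\
  ((forall a : 'I_H.+1, x (enum_rank (i0, a)) =
     u i0 ^+ ((e + a) %/ H.+1) * x (enum_rank (i0, ord0))) /\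
  ((forall a : 'I_(p ^ r), (size bs <= a)%N -> (R x)`_a = (a == size bs :> nat)%:R) /\
   (forall T, T \in Ts -> T.@[fun i : 'I_(size bs) => (R x)`_i ^+ (p ^ r)] = 0))).
have Rpoly a : polyfun (fun x => (R x)`_a).
  have [P PE] : polyfun (fun x => \sum_i y x i * phi (lagrange_poly beta i)`_a).
    apply: polyfun_sum => i; apply/polyfunM/polyfun_cst/polyfunM/polyfun_cst.
    exact: polyfun_coord.
  by exists P => x; rewrite PE coef_interp.
have szQ : (size bs <= p ^ r.-1)%N -> (size bs < p ^ r)%N.
  by move/leq_ltn_trans; apply; rewrite ltn_exp2l // prednK.
have orbE n : (n %% H.+1)%N = e <-> forall a : 'I_H.+1, @carry_orbit K (p ^ r)%N H u n (enum_rank (i0, a)) =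
     u i0 ^+ ((e + a) %/ H.+1) * @carry_orbit K (p ^ r)%N H u n (enum_rank (i0, ord0)).
  rewrite -(carry_pattern_mod n (u0 i0) (@u1 i0) (ltn_pmod s (ltn0Sn H))).
  by split=> E a; have := E a; rewrite !carry_orbitE addn0.
have RE n : (d <= n %/ H.+1)%N ->
    R (@carry_orbit K (p ^ r)%N H u n) = map_poly iota (power_interp b (k * w) (n %/ H.+1 - d)).
  move=> dn; rewrite (map_interp _ _ (psi := phi)) //; apply: eq_interp => i /=.
  rewrite /y carry_orbitE addn0 rmorphXn /= -/(u i) -{1}(subnK dn) exprD -mulrA -exprMn.
  by rewrite mulfV // expr1n mulr1.
exists Z; split.
- apply/zariski_closed_guard/zariski_closed_and; last apply: zariski_closed_and.
  + apply: zariski_closed_all => a; apply: zariski_closed_eq; first exact: polyfun_coord.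
    by apply: polyfunM; [exact: polyfun_cst | exact: polyfun_coord].
  + apply: zariski_closed_all => a; apply: zariski_closed_imp.
    by apply: zariski_closed_eq => //; exact: polyfun_cst.
  + apply: zariski_closed_all_in => T; apply: zariski_closed_eq; last exact: polyfun_cst.
    apply: (@polyfun_comp _ _ _ T (fun i x => (R x)`_i ^+ (p ^ r))) => i.
    exact: polyfunX.
- move=> n [szbs [/orbE ne [/(monic_of_coef _ (szQ szbs)) RM TR]]].
  have [//|mR sR] := RM; first exact: size_interp.
  (* A negative [nu] is excluded because the interpolant is monic. *)
  have [lt|dn] := ltnP (n %/ H.+1) d.
    suff /negP[] : ~~ (R (@carry_orbit K (p ^ r)%N H u n) \is monic) by [].
    apply: (@interp_inv_not_monic _ _ beta K phi iota b (d - n %/ H.+1)%N) => //.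
      by rewrite subn_gt0.
    move=> i; rewrite /y carry_orbitE addn0 -/(u i) mulrAC -exprD subnKC ?(ltnW lt) //.
    by rewrite -exprMn mulfV // expr1n.
  have RnE := RE n dn; set nu := (n %/ H.+1 - d)%N in RnE.
  have mR0 : power_interp b (k * w) nu \is monic.
    by move: mR; rewrite RnE !monicE lead_coef_map_inj ?rmorph0 // -{1}(rmorph1 iota) (inj_eq iota_inj).
  have sR0 : size (power_interp b (k * w) nu) = (size bs).+1.
    by rewrite -sR RnE (size_map_inj_poly iota_inj (rmorph0 iota)).
  have kwr : (k * w < r)%N by rewrite ltn_pmul2l.
  have [|g [gr gE]] := power_interp_blocks pL iota_inj r0 b_inj b_fix b_surj TsE kwr szbs mR0 sR0.
    move=> T /TR; rewrite RnE => <-; apply: meval_eq => i.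
    by rewrite coef_map.
  have gk j : j \in A -> g j = (k * (g j %/ k))%N.
    move=> jA; have jbs : j \in bs by rewrite mem_block_seq jA muln_gt0 c0 expn_gt0 q0.
    have : (k %| g j + k * w)%N by apply: dvdn_trans (gr j jbs); rewrite dvdn_mulr.
    by rewrite dvdn_addl ?dvdn_mulr // mulnC => /divnK.
  (* The block of [j] has [c_j q^sigma_j] entries, each contributing [p^(g j) = q^(g j %/ k)]. *)
  pose e' j := (sigma j + g j %/ k)%N.
  have {}gE : (\sum_(j in A) c j * q ^ e' j = nu * q ^ N)%N.
    rewrite qN -gE sum_block_seq; apply: eq_bigr => j jA.
    by rewrite expnD mulnA {2}(gk j jA) expnM.
  (* The sum is divisible by [q^N], so [e' j >= N - l * #|A| >= N - h], and the exponent
     [e' j + h - N] chosen below is not truncated. *)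
  have e'N j : j \in A -> (N <= e' j + h)%N.
    move=> jA; apply: (@leq_trans (e' j + l * #|A|)).
      apply: (dvdn_sum_pow_gap q1 (c := c) (A := A)) => //.
        apply: leq_trans (ltnW (ltn_expl l q1)); rewrite /l [leqRHS](bigID (mem A)) /=.
        exact: leq_addr.
      by rewrite gE dvdn_mull.
    by rewrite leq_add2l /h leq_mul2l (leq_trans (max_card _)) ?orbT // card_ord.
  exists (fun j => if j \in A then e' j + h - N else v j)%N.
  rewrite (bigID (mem A)) /= addnC.
  have -> : (\sum_(i < m | i \notin A) c i * q ^ (if i \in A then e' i + h - N else v i) = s)%N.
    by apply: eq_bigr => j /negPf ->.
  have -> : (\sum_(i < m | i \in A) c i * q ^ (if i \in A then e' i + h - N else v i) = nu * H.+1)%N.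
    have qN0 : (0 < q ^ N)%N by rewrite qN.
    apply/eqP; rewrite -(eqn_pmul2r qN0) mulnAC -gE HE.
    rewrite !big_distrl /=; apply/eqP; apply: eq_bigr => j jA.
    by rewrite jA -!mulnA -!expnD subnK ?e'N.
  rewrite {1}(divn_eq n H.+1) ne {1}(divn_eq s H.+1) -/e -/d -(subnK dn) -/nu.
  by rewrite mulnDl; lia.
- move=> n en nE env esig szbs.
  pose nu := (\sum_(j in A) c j * q ^ (en j - h))%N.
  have nsE : (n = nu * H.+1 + s)%N.
    rewrite nE (bigID (mem A)) /=; congr (_ + _)%N; last first.
      by apply: eq_bigr => j jA; rewrite env.
    rewrite HE big_distrl /=; apply: eq_bigr => j jA.
    by rewrite -mulnA -expnD subnK //; case: (esig j jA).
  have nd : (n %/ H.+1 = nu + d)%N by rewrite nsE divnMDl.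
  have dn : (d <= n %/ H.+1)%N by rewrite nd leq_addl.
  have RnE := RE n dn; rewrite nd addnK in RnE.
  have [|||mR RF] := @power_interp_sum p L pL r b r0 b_inj b_fix k N w nu _ A c sigma
    (fun j => en j - h)%N (erefl _) wN.
  + by move=> j /esig[].
  + by [].
  + by [].
  split=> //; split; [|split].
  + by apply/orbE; rewrite nsE modnMDl.
  + apply/(monic_of_coef _ (szQ szbs)); first exact: size_interp.
    rewrite RnE (size_map_inj_poly iota_inj (rmorph0 iota)); split.
      by rewrite monicE lead_coef_map_inj ?rmorph0 // (monicP mR) rmorph1.
    rewrite -(size_map_inj_poly _ (rmorph0 (frobn r pP))) ?RF ?size_prod_XsubC //.
    exact: expr_pexp_inj.
  + pose E j := (p ^ (k * (en j - h + N - sigma j)))%N.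
    pose cs := map_tuple (fun j => iota 'X^(E j)) (in_tuple bs).
    have csE : \prod_(z <- cs) ('X - z%:P) =
        map_poly iota (map_poly (frobn r pP) (power_interp b (k * w) nu)).
      rewrite RF rmorph_prod big_map; apply: eq_bigr => j _.
      by rewrite rmorphB /= map_polyX map_polyC.
    move=> T /(proj2 (TsE cs)) TE; rewrite -[RHS]TE.
      by apply: meval_eq => i; rewrite csE RnE !coef_map /= rmorphXn.
    (* The roots are already listed block by block, so the identity permutation works. *)
    by exists 1%g => i; rewrite !perm1 !tnth_map tnth_first_index.
Qed.

End Pieces.

(** * The set as a finite union of closed pieces *)

Theorem theorem3p1 (p k : nat) (L : closedFieldType) (m : nat) (c : 'I_m -> nat) :
  prime p -> (0 < k)%N -> is_alg_closure_Fp p L ->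
  (0 < m)%N -> (forall j, 0 < c j)%N ->
  DML_set_split_torus {fraction {poly L}} (B_set (p ^ k) c).
Proof.
move=> p_pr k0 [pL _] m0 c0; have p1 := prime_gt1 p_pr.
pose K : fieldType := {fraction {poly L}}.
pose iota : {rmorphism {poly L} -> K} := @FracField.tofrac {poly L}.
have iota_inj : injective iota by move=> P P' /eqP; rewrite tofrac_eq => /eqP.
pose l := (\sum_j c j)%N; pose h := (l * m)%N; pose N := (m * l).+1; pose q := (p ^ k)%N.
have q1 : (1 < q)%N by rewrite -(expn0 p) ltn_exp2l.
have [T [uT sT TE]] : exists T : seq L, [/\ uniq T, size T = (p ^ (k * N))%N &
    forall x, (x \in T) = (x ^+ (p ^ (k * N)) == x)].
  by apply: frobenius_fixed_points; rewrite // muln_gt0 k0.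
pose b (i : 'I_(p ^ (k * N))) := T`_i.
have bT i : b i \in T by rewrite mem_nth // sT.
have b_inj : injective b.
  by move=> i j /eqP; rewrite nth_uniq ?sT // => /eqP /val_inj.
have b_fix i : b i ^+ (p ^ (k * N)) = b i by apply/eqP; rewrite -TE.
have b_surj x : x ^+ (p ^ (k * N)) = x -> exists i, b i = x.
  move/eqP; rewrite -TE => xT.
  have iP : (index x T < p ^ (k * N))%N by rewrite -sT index_mem.
  by exists (Ordinal iP); rewrite /b nth_index.
pose piece := ({set 'I_m} * {ffun 'I_m -> 'I_h.+1} * {ffun 'I_m -> 'I_N} * 'I_N)%type.
have /fin_all_exists[Z ZP] (x : piece) := piece_closed pL iota_inj k0 c0 b_inj b_fix b_surj
  x.1.1.1 (fun j => x.1.1.2 j) (fun j => x.1.2 j) (ltn_ord x.2).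
apply: (@DML_set_carry_orbit _ _ (q ^ h).-1 (fun i => iota ((b i)%:P - 'X)) _
  (fun y => exists x, Z x y)).
- by move=> i; rewrite tofrac_eq0 -opprB oppr_eq0 polyXsubC_eq0.
- by rewrite expn_gt0 ltnW.
- by apply: zariski_closed_ex => x; case: (ZP x).
move=> n; split=> [[e nE]|[x]]; last by case: (ZP x) => _ + _; apply.
have [w wN wP] := exists_rotation l (fun j => e j - h)%N.
pose A := [set j | h <= e j]%N.
(* The entry [inord (e j)] is faithful outside [A], where [e j < h], and a dummy on [A]. *)
pose x : piece := (A, [ffun j => inord (e j)],
  [ffun j => Ordinal (ltn_pmod (e j - h + w) (ltn0Sn (m * l)))], Ordinal wN).
exists x; case: (ZP x) => _ _; apply; first exact: nE.
- by move=> j; rewrite inE -ltnNge => ltj; rewrite ffunE inordK // ltnW.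
- by move=> j; rewrite inE ffunE.
rewrite size_block_seq /=.
have lml : (l <= m * l)%N by rewrite leq_pmull.
(* The rotation gives [sigma_j <= m l - l], so the degree is at most
   [l q^(m l - l) <= q^(m l) <= p^(k N - 1)]. *)
apply: (@leq_trans (l * q ^ (m * l - l))).
  apply: (@leq_trans (\sum_(j in A) c j * q ^ (m * l - l))).
    apply: leq_sum => j _; rewrite ffunE /= leq_mul2l leq_exp2l //.
    by rewrite -ltnS -subSn // wP orbT.
  by rewrite -big_distrl /= leq_mul2r /l [leqRHS](bigID (mem A)) /= leq_addr orbT.
apply: (@leq_trans (q ^ (m * l))).
  rewrite -{2}(subnKC lml) expnD leq_mul2r; apply/orP; right.
  exact/ltnW/ltn_expl.
rewrite /q -expnM leq_exp2l // -ltnS prednK ?muln_gt0 ?k0 // /N mulnS.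
by rewrite -[ltnLHS]add0n ltn_add2r.
Qed.
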